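(* Let $d\in\mathbb{N}$, $M\in(0,\infty)$, and let $\mathcal{P}$ be a partition of $\mathbb{R}^d$ such that every member has outer Lebesgue measure at most $M$. Let $\mathbb{R}^d$ be equipped with an arbitrary norm $\|\cdot\|$, and let $v_{\|\cdot\|,d}$ denote the Lebesgue measure of the open unit ball $\{\vec{x}:\|\vec{x}\|<1\}$. Then for every $\varepsilon\in(0,\infty)$ there exists $\vec{p}\in\mathbb{R}^d$ such that the open ball $\{\vec{x}:\|\vec{x}-\vec{p}\|<\varepsilon\}$ intersects at least $k=\left\lceil\left(1+\varepsilon\left(\frac{v_{\|\cdot\|,d}}{M}\right)^{1/d}\right)^d\right\rceil$ members of $\mathcal{P}$. *)

(* Defs.v *)
From HB Require Import structures.
From mathcomp Require Import all_boot all_order all_algebra.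
From mathcomp Require Import all_classical all_reals all_analysis.

Set Implicit Arguments.
Unset Strict Implicit.
Unset Printing Implicit Defensive.
Import Order.TTheory GRing.Theory Num.Theory.
Import numFieldNormedType.Exports.

Local Open Scope classical_set_scope.
Local Open Scope ring_scope.

(* ['rV[R]_d] already carries the sup norm as its canonical norm, so an
   arbitrary norm on R^d is a function satisfying the norm axioms. *)
Record is_norm (R : realType) (d : nat) (N : 'rV[R]_d -> R) : Prop := IsNorm {
  norm_triangle : forall x y, N (x + y) <= N x + N y ;
  norm_homogeneous : forall (a : R) x, N (a *: x) = `|a| * N x ;
  norm_definite : forall x, N x = 0 -> x = 0 }.

Definition norm_ball (R : realType) (d : nat) (N : 'rV[R]_d -> R)
    (p : 'rV[R]_d) (r : R) : set 'rV[R]_d :=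
  [set x | N (x - p) < r].

Definition box (R : realType) (d : nat) (B : 'rV[R]_d * 'rV[R]_d) :
    set 'rV[R]_d :=
  [set x | forall i, B.1 ord0 i < x ord0 i <= B.2 ord0 i].

(* Sides are truncated at 0: a pair with [B.2 ord0 i < B.1 ord0 i] for some [i]
   denotes the empty box. *)
Definition box_volume (R : realType) (d : nat) (B : 'rV[R]_d * 'rV[R]_d) : R :=
  \prod_(i < d) Num.max 0 (B.2 ord0 i - B.1 ord0 i).

(* Countable covers by boxes, indexed by a set [C.1] of naturals so that finite
   and empty covers are allowed: in dimension 0 no box is empty. *)
Definition box_cover (R : realType) (d : nat) (A : set 'rV[R]_d) :
    set (set nat * (nat -> 'rV[R]_d * 'rV[R]_d)) :=
  [set C | A `<=` \bigcup_(k in C.1) box (C.2 k)].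

Definition lebesgue_outer (R : realType) (d : nat) (A : set 'rV[R]_d) : \bar R :=
  ereal_inf [set (\esum_(k in C.1) (box_volume (C.2 k))%:E)%E
            | C in box_cover A].

Section lebesgue_outer.
Context (R : realType) (d : nat).
Local Notation mu := (@lebesgue_outer R d).
Local Open Scope ereal_scope.

Lemma box_volume_ge0 (B : 'rV[R]_d * 'rV[R]_d) : (0 <= box_volume B)%R.
Proof. by apply: prodr_ge0 => i _; rewrite le_max lexx. Qed.

Lemma lebesgue_outer_ge0 (A : set 'rV[R]_d) : 0 <= mu A.
Proof.
apply: le_ereal_inf_tmp => _ [C _ <-]; apply: esum_ge0 => k _.
by rewrite lee_fin box_volume_ge0.
Qed.

Lemma lebesgue_outer0 : mu set0 = 0.
Proof.
apply/eqP; rewrite eq_le lebesgue_outer_ge0 andbT; apply: ereal_inf_lbound.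
by exists (set0, fun=> (0%R, 0%R)) => //=; rewrite esum_set0.
Qed.

Lemma le_lebesgue_outer : {homo mu : A B / A `<=` B >-> A <= B}.
Proof.
move=> A B AB; apply: ereal_inf_le_tmp => _ [C BC <-].
by exists C => //; exact: subset_trans BC.
Qed.

Lemma lebesgue_outer_sigma_subadditive : sigma_subadditive mu.
Proof.
move=> A; have [[i ioo]|] := pselect (exists i, mu (A i) = +oo).
  rewrite (eseries_pinfty _ _ ioo) ?leey// => n _.
  by rewrite -ltNye (lt_le_trans _ (lebesgue_outer_ge0 _)).
rewrite -forallNE => Aoo.
apply/lee_addgt0Pr => e e0.
rewrite (le_trans _ (epsilon_trick _ _ (ltW e0)))//; last first.
  by move=> n; exact: lebesgue_outer_ge0.
pose P n (C : set nat * (nat -> 'rV[R]_d * 'rV[R]_d)) := box_cover (A n) C /\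
  \esum_(k in C.1) (box_volume (C.2 k))%:E
    <= mu (A n) + (e / (2 ^ n.+1)%:R)%:E.
have [G PG] : {G & forall n, P n (G n)}.
  apply: (@choice _ _ P) => n.
  have en : (0 < e / (2 ^ n.+1)%:R)%R by rewrite divr_gt0// ltr0n expn_gt0.
  have fA : mu (A n) \is a fin_num.
    by rewrite ge0_fin_numE ?lebesgue_outer_ge0// ltey; exact/eqP.
  have [_ [C AC <-] /ltW leC] := lb_ereal_inf_adherent en fA.
  by exists C.
have v0 (B : 'rV[R]_d * 'rV[R]_d) : 0 <= (box_volume B)%:E.
  by rewrite lee_fin box_volume_ge0.
have /card_esym/ppcard_eqP[f] := card_nat2.
rewrite nneseries_esumT; last first.
  move=> n; rewrite adde_ge0 ?lebesgue_outer_ge0// lee_fin.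
  by rewrite divr_ge0 ?ler0n ?ltW.
apply: le_trans (le_esum (fun n _ => (PG n).2)).
rewrite esum_esum//.
apply: ereal_inf_lbound.
exists ([set k | (G (f k).1).1 (f k).2], fun k => (G (f k).1).2 (f k).2) => /=.
  move=> t [n _ /(PG n).1 [k Gk tk]]; exists (f^-1%FUN (n, k)) => /=.
    by rewrite invK ?inE.
  by rewrite invK ?inE.
apply/esym/reindex_esum; split.
- by move=> k /= Gk; split.
- by move=> i j _ _; apply: inj; rewrite inE.
- move=> [n k] [_ /= Gk]; exists (f^-1%FUN (n, k)) => /=; rewrite invK ?inE//.
Qed.

HB.instance Definition _ := isOuterMeasure.Build R 'rV[R]_d mu
  lebesgue_outer0 lebesgue_outer_ge0 le_lebesgue_outer
  lebesgue_outer_sigma_subadditive.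

End lebesgue_outer.

(* The complete measure obtained from the outer measure by Caratheodory's
   theorem; its values are meaningful on Caratheodory-measurable sets, in
   particular on open sets. *)
Definition lebesgue_rV (R : realType) (d : nat) :
    set (caratheodory_type (@lebesgue_outer R d)) -> \bar R :=
  @lebesgue_outer R d.

HB.instance Definition _ (R : realType) (d : nat) :=
  isMeasure.Build _ (caratheodory_type (@lebesgue_outer R d)) R
    (@lebesgue_rV R d)
    (@caratheodory_measure0 R _ (@lebesgue_outer R d))
    (@caratheodory_measure_ge0 R _ (@lebesgue_outer R d))
    (@caratheodory_measure_sigma_additive R _ (@lebesgue_outer R d)).

(* Main.v *)
Require Import Defs.
From HB Require Import structures.
From mathcomp Require Import all_boot all_order all_algebra.
From mathcomp Require Import all_classical all_reals all_analysis.
From mathcomp Require Import measurable_realfun ring lra.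

(* Suppose every ball of radius e meets at most k - 1 members, so that a large
   cube S meets only finitely many of them. A member A meets the ball around p
   iff p lies in A + B_e, and the Brunn-Minkowski inequality together with
   mu A <= M gives mu (A `&` S + B_e) >= c^d mu (A `&` S), where
   c = 1 + e (v / M)^(1/d). Summing over the members meeting S, the sets
   A `&` S + B_e have total measure at least c^d mu S, but they cover each
   point of the slightly larger cube S + B_e at most k - 1 times. Letting S
   grow yields c^d <= k - 1, which contradicts k = ceil (c^d).
   Brunn-Minkowski is needed for an arbitrary set plus a ball: thickening makes
   the set open, open sets are exhausted by dyadic boxes, and for finite unions
   of boxes it is the Hadwiger-Ohmann induction. *)

Set Implicit Arguments.
Unset Strict Implicit.
Unset Printing Implicit Defensive.
Import Order.TTheory GRing.Theory Num.Theory.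
Import numFieldNormedType.Exports.

Local Open Scope classical_set_scope.
Local Open Scope ring_scope.

(** * Boxes and half-spaces *)

Section boxes.
Context (R : realType) (d : nat).
Implicit Types (B : 'rV[R]_d * 'rV[R]_d) (i : 'I_d) (t : R).

Definition set_coord (x : 'rV[R]_d) i t : 'rV[R]_d :=
  \row_j (if j == i then t else x ord0 j).

(** Half-open sides make both pieces of a cut boxes again, without overlap or gap. A cut that misses
    [B] leaves one piece empty, its volume truncated to 0. *)
Definition cut_below i t B : 'rV[R]_d * 'rV[R]_d :=
  (B.1, set_coord B.2 i (Num.min (B.2 ord0 i) t)).

Definition cut_above i t B : 'rV[R]_d * 'rV[R]_d :=
  (set_coord B.1 i (Num.max (B.1 ord0 i) t), B.2).

Lemma box_cut_below i t B :
  box (cut_below i t B) = box B `&` [set x | x ord0 i <= t].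
Proof.
apply/seteqP; split => x /=.
  move=> h; split; last first.
    by have := h i; rewrite /= mxE eqxx le_min => /andP[_ /andP[]].
  move=> j; have := h j; rewrite /= mxE; case: eqP => [->|//].
  by rewrite le_min => /andP[-> /andP[->]].
move=> [h xt] j; rewrite /= mxE; case: eqP => [->|_]; last exact: h.
by have /andP[-> /=] := h i; rewrite le_min xt andbT.
Qed.

Lemma box_cut_above i t B :
  box (cut_above i t B) = box B `&` [set x | t < x ord0 i].
Proof.
apply/seteqP; split => x /=.
  move=> h; split; last first.
    by have := h i; rewrite /= mxE eqxx gt_max => /andP[/andP[]].
  move=> j; have := h j; rewrite /= mxE; case: eqP => [->|//].
  by rewrite gt_max => /andP[/andP[-> _] ->].
move=> [h xt] j; rewrite /= mxE; case: eqP => [->|_]; last exact: h.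
by have /andP[h1 ->] := h i; rewrite gt_max xt h1.
Qed.

Lemma box_volume_cut_below i t B : box_volume (cut_below i t B) =
  Num.max 0 (Num.min (B.2 ord0 i) t - B.1 ord0 i) *
  \prod_(j < d | j != i) Num.max 0 (B.2 ord0 j - B.1 ord0 j).
Proof.
rewrite /box_volume (bigD1 i)//= mxE eqxx; congr *%R.
by apply: eq_bigr => j /negbTE ji; rewrite mxE ji.
Qed.

Lemma box_volume_cut_above i t B : box_volume (cut_above i t B) =
  Num.max 0 (B.2 ord0 i - Num.max (B.1 ord0 i) t) *
  \prod_(j < d | j != i) Num.max 0 (B.2 ord0 j - B.1 ord0 j).
Proof.
rewrite /box_volume (bigD1 i)//= mxE eqxx; congr *%R.
by apply: eq_bigr => j /negbTE ji; rewrite mxE ji.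
Qed.

Lemma box_volume_cut i t B :
  box_volume (cut_below i t B) + box_volume (cut_above i t B) = box_volume B.
Proof.
rewrite box_volume_cut_below box_volume_cut_above -mulrDl.
rewrite [RHS](bigD1 i)//=; congr *%R.
set a := B.1 ord0 i; set b := B.2 ord0 i.
case: (leP b t) => bt; case: (leP a t) => at_; rewrite !maxEle !subr_ge0;
  do ![case: ifPn => [|/negP/negP]; rewrite -?ltNge => ?]; lra.
Qed.

(** Cutting every box of a cover of [E] at [t] covers both halves at the same total volume. This is
    Caratheodory's criterion for the half-space. *)
Lemma lebesgue_outer_half_space i t (E : set 'rV[R]_d) :
  (lebesgue_outer (E `&` [set x | (x ord0 i <= t)%R]) +
   lebesgue_outer (E `&` [set x | (t < x ord0 i)%R]) <= lebesgue_outer E)%E.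
Proof.
apply: le_ereal_inf_tmp => _ [C EC <-].
have v0 B : (0 <= (box_volume B)%:E)%E by rewrite lee_fin box_volume_ge0.
under eq_esum => k _ do rewrite -(box_volume_cut i t) EFinD.
rewrite esumD//; apply: leeD; apply: ereal_inf_lbound.
- exists (C.1, fun k => cut_below i t (C.2 k)) => //= x [/EC[k Ck Bk] xt].
  by exists k => //=; rewrite box_cut_below.
- exists (C.1, fun k => cut_above i t (C.2 k)) => //= x [/EC[k Ck Bk] xt].
  by exists k => //=; rewrite box_cut_above.
Qed.

Local Notation cara := (caratheodory_type (@lebesgue_outer R d)).

Lemma measurable_half_space i t :
  measurable ([set x | x ord0 i <= t] : set cara).
Proof.
apply: le_caratheodory_measurable => X.
have -> : ~` [set x : 'rV[R]_d | x ord0 i <= t] = [set x | t < x ord0 i].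
  by apply/seteqP; split => x /=; rewrite ltNge => /negP.
exact: lebesgue_outer_half_space.
Qed.

Lemma measurable_box B : measurable (box B : set cara).
Proof.
have -> : box B = \bigcap_(i in [set: 'I_d])
    (~` [set x | x ord0 i <= B.1 ord0 i] `&` [set x | x ord0 i <= B.2 ord0 i]).
  apply/seteqP; split => x.
    move=> Bx i _; have /andP[h1 h2] := Bx i; split => //=.
    by apply/negP; rewrite -ltNge.
  move=> h i; have [/= /negP] := h i I.
  by rewrite -ltNge => -> ->.
apply: fin_bigcap_measurable => // i _.
apply: measurableI; last exact: measurable_half_space.
by apply: measurableC; exact: measurable_half_space.
Qed.

End boxes.

(** * The measure of a box *)

Section box_measure.
Context (R : realType) (d : nat).
Implicit Types (B : 'rV[R]_d * 'rV[R]_d) (x : 'rV[R]_d).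

(* The indicator function of [box B] with its first [j] coordinates integrated
   out. *)
Definition box_marginal (j : nat) B x : R :=
  \prod_(i < d) (if (i < j)%N then Num.max 0 (B.2 ord0 i - B.1 ord0 i)
                 else \1_(`]B.1 ord0 i, B.2 ord0 i]%classic) (x ord0 i)).

Lemma box_marginal_ge0 j B x : 0 <= box_marginal j B x.
Proof.
apply: prodr_ge0 => i _; case: ifP => _; first by rewrite le_max lexx.
by rewrite indicE ler0n.
Qed.

Lemma box_marginal_full B x : box_marginal d B x = box_volume B.
Proof. by apply: eq_bigr => i _; rewrite ltn_ord. Qed.

Lemma box_marginal0_in B x : box B x -> box_marginal 0 B x = 1.
Proof.
move=> Bx; apply: big1 => i _ /=; rewrite indicE mem_set//=.
by rewrite in_itv /=; exact: Bx.
Qed.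

Lemma box_marginal0_notin B x : ~ box B x -> box_marginal 0 B x = 0.
Proof.
move=> /existsNP[i Bxi]; rewrite /box_marginal (bigD1 i)//= indicE
  memNset ?mul0r//=.
Qed.

Let rest (j : 'I_d) B x : R :=
  \prod_(i < d | i != j) (if (i < j)%N then Num.max 0 (B.2 ord0 i - B.1 ord0 i)
                 else \1_(`]B.1 ord0 i, B.2 ord0 i]%classic) (x ord0 i)).

Let rest_ge0 j B x : 0 <= rest j B x.
Proof.
apply: prodr_ge0 => i _; case: ifP => _; first by rewrite le_max lexx.
by rewrite indicE ler0n.
Qed.

Let box_marginalS (j : 'I_d) B x :
  box_marginal j.+1 B x = rest j B x * Num.max 0 (B.2 ord0 j - B.1 ord0 j).
Proof.
rewrite /box_marginal (bigD1 j)//= ltnSn mulrC; congr *%R.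
by apply: eq_bigr => i /negbTE ij; rewrite ltnS leq_eqVlt val_eqE ij.
Qed.

Let box_marginal_coord (j : 'I_d) B x t :
  box_marginal j B (set_coord x j t) =
  rest j B x * \1_(`]B.1 ord0 j, B.2 ord0 j]%classic) t.
Proof.
rewrite /box_marginal (bigD1 j)//= ltnn mxE eqxx mulrC; congr *%R.
by apply: eq_bigr => i /negbTE ij; rewrite mxE ij.
Qed.

Lemma measurable_box_marginal (j : 'I_d) B x :
  measurable_fun [set: R] (fun t => box_marginal j B (set_coord x j t)).
Proof.
under eq_fun do rewrite box_marginal_coord.
by apply: measurable_funM => //; exact: measurable_indic.
Qed.

Lemma integral_box_marginal (j : 'I_d) B x :
  (\int[lebesgue_measure]_t (box_marginal j B (set_coord x j t))%:E =
   (box_marginal j.+1 B x)%:E)%E.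
Proof.
rewrite box_marginalS EFinM.
under eq_integral do rewrite box_marginal_coord EFinM.
rewrite ge0_integralZl_EFin//; last first.
  by apply/measurable_EFinP; exact: measurable_indic.
rewrite integral_indic//= setIT lebesgue_measure_itv/= lte_fin.
by rewrite maxElt subr_gt0; case: ifP.
Qed.

(** The indicator of [box B] is at most the sum of those of the covering boxes. Integrating this
    inequality over one coordinate at a time turns indicators into volumes after [d] steps. *)
Lemma box_volume_cover B (C : set nat * (nat -> 'rV[R]_d * 'rV[R]_d)) :
  box_cover (box B) C ->
  ((box_volume B)%:E <= \esum_(k in C.1) (box_volume (C.2 k))%:E)%E.
Proof.
move=> BC.
(* The weight [c] extends the sum over the index set to a series over all naturals, which can be
   integrated term by term. *)
pose c k : R := (k \in C.1)%:R.
have c0 k : 0 <= c k by rewrite ler0n.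
have t0 j k x : (0 <= (c k * box_marginal j (C.2 k) x)%:E)%E.
  by rewrite lee_fin mulr_ge0 ?box_marginal_ge0.
have mt (j : 'I_d) k x : measurable_fun [set: R]
    (fun t => (c k * box_marginal j (C.2 k) (set_coord x j t))%:E).
  apply/measurable_EFinP; apply: measurable_funM => //.
  exact: measurable_box_marginal.
suff H j : (j <= d)%N -> forall x, ((box_marginal j B x)%:E <=
    \sum_(0 <= k <oo) (c k * box_marginal j (C.2 k) x)%:E)%E.
  have := H _ (leqnn d) 0; rewrite box_marginal_full => /le_trans; apply.
  rewrite nneseries_esumT//= [leRHS]esum_mkcond; apply: le_esum => k _.
  by rewrite box_marginal_full /c; case: ifP => _; rewrite ?mul1r ?mul0r.
elim: j => [_ x|j IH jd x].
  have [Bx|Bx] := pselect (box B x); last first.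
    by rewrite box_marginal0_notin//; exact: nneseries_ge0.
  have [k Ck Cx] := BC x Bx; rewrite box_marginal0_in//.
  apply: le_trans (nneseries_lim_ge k.+1 _) => //.
  rewrite big_nat_recr//= /c mem_set// box_marginal0_in// mul1r.
  by apply: leeDr; apply: sume_ge0 => i _; exact: t0.
pose J := Ordinal jd.
rewrite -(integral_box_marginal J).
have -> : (\sum_(0 <= k <oo) (c k * box_marginal j.+1 (C.2 k) x)%:E =
    \int[lebesgue_measure]_t
      \sum_(0 <= k <oo) (c k * box_marginal j (C.2 k) (set_coord x J t))%:E)%E.
  rewrite integral_nneseries//.
  - apply: eq_eseriesr => k _; rewrite EFinM -(integral_box_marginal J).
    rewrite -ge0_integralZl_EFin//.
    + by move=> t _; rewrite lee_fin box_marginal_ge0.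
    + by apply/measurable_EFinP; exact: (measurable_box_marginal J).
  - by move=> k; exact: (mt J).
apply: ge0_le_integral => //.
- by move=> t _; rewrite lee_fin box_marginal_ge0.
- by apply/measurable_EFinP; exact: (measurable_box_marginal J).
- by apply: ge0_emeasurable_sum => // k _; exact: (mt J).
- by move=> t _; apply: IH; exact: ltnW.
Qed.

Lemma lebesgue_outer_box B : lebesgue_outer (box B) = (box_volume B)%:E.
Proof.
apply/eqP; rewrite eq_le; apply/andP; split; last first.
  by apply: le_ereal_inf_tmp => _ [C BC <-]; exact: box_volume_cover.
apply: ereal_inf_lbound; exists ([set 0%N], fun=> B) => /=.
  by rewrite /box_cover/= bigcup_set1.
by rewrite esum_set1// lee_fin box_volume_ge0.
Qed.

(** Shrinking a cover of the dilate by [r] gives a cover of [A] with volumes divided by [r ^+ d]. *)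
Lemma lebesgue_outer_scale (r : R) (A : set 'rV[R]_d) : 0 < r ->
  (((r ^+ d)%:E * lebesgue_outer A) <=
   lebesgue_outer [set x | A (r^-1 *: x)%R])%E.
Proof.
move=> r0; apply: le_ereal_inf_tmp => _ [C AC <-].
rewrite -lee_pdivlMl ?exprn_gt0//.
pose D := (C.1, fun k => (r^-1 *: (C.2 k).1, r^-1 *: (C.2 k).2)).
have ri0 : 0 < r^-1 by rewrite invr_gt0.
apply: (@le_trans _ _ (\esum_(k in D.1) (box_volume (D.2 k))%:E)%E).
  apply: ereal_inf_lbound; exists D => //= x Ax.
  have [|k Ck Bk] := AC (r *: x).
    by rewrite /= scalerA mulVf ?gt_eqF// scale1r.
  exists k => //= i; have /andP[h1 h2] := Bk i.
  rewrite !mxE in h1 h2 *; rewrite mulrC ltr_pdivrMr// mulrC h1/=.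
  by rewrite ler_pdivlMl.
have v0 (B : 'rV[R]_d * 'rV[R]_d) : (0 <= (box_volume B)%:E)%E.
  by rewrite lee_fin box_volume_ge0.
have vD k : box_volume (D.2 k) = (r ^+ d)^-1 * box_volume (C.2 k).
  rewrite -exprVn /box_volume -[in X in _ ^+ X](card_ord d) -prodr_const.
  rewrite -big_split/=; apply: eq_bigr => i _.
  by rewrite !mxE -mulrBr maxr_pMr ?mulr0 // ltW.
rewrite esum_mkcond [in leRHS]esum_mkcond -!nneseries_esumT; last 2 first.
- by move=> k; case: ifP.
- by move=> k; case: ifP.
rewrite -nneseriesZl; last by move=> k _; case: ifP.
apply: lee_nneseries => k _; first by case: ifP.
by case: ifP => _; rewrite ?mule0// vD EFinM.
Qed.

End box_measure.

(** * Finite unions of separated boxes *)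

Section separated_boxes.
Context (R : realType) (d : nat).
Local Notation boxT := ('rV[R]_d * 'rV[R]_d)%type.
Implicit Types (B C : boxT) (s : seq boxT) (i : 'I_d) (t : R).

Definition box_nondegenerate B : bool := [forall i, B.1 ord0 i < B.2 ord0 i].

(** Phrased through a coordinate hyperplane rather than as disjointness, since the Hadwiger-Ohmann
    induction cuts along this hyperplane. *)
Definition box_separated B C : bool :=
  [exists i, (B.2 ord0 i <= C.1 ord0 i) || (C.2 ord0 i <= B.1 ord0 i)].

Definition box_union s : set 'rV[R]_d := \bigcup_(B in [set` s]) box B.

Definition total_volume s : R := \sum_(B <- s) box_volume B.

(** Degenerate pieces are discarded, so a box on one side of the cut disappears from the list of the
    other side. This shortening drives the Hadwiger-Ohmann induction. *)
Definition cut_seq (f : boxT -> boxT) s : seq boxT :=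
  [seq B <- map f s | box_nondegenerate B].

Lemma box_union_cons B s : box_union (B :: s) = box B `|` box_union s.
Proof.
apply/seteqP; split => x.
  by move=> [C]; rewrite /= inE => /predU1P[->|Cs] Cx; [left|right; exists C].
move=> [Bx|[C Cs Cx]]; first by exists B; rewrite //= mem_head.
by exists C; rewrite //= inE Cs orbT.
Qed.

Lemma box_union_nil : box_union [::] = set0.
Proof. by apply/seteqP; split => x // []. Qed.

Lemma measurable_box_union s :
  measurable (box_union s : set (caratheodory_type (@lebesgue_outer R d))).
Proof.
elim: s => [|B s IH]; first by rewrite box_union_nil.
by rewrite box_union_cons; apply: measurableU => //; exact: measurable_box.
Qed.

Lemma box_separated_disjoint B C : box_separated B C -> box B `&` box C = set0.
Proof.
move=> /existsP[i BC]; apply/seteqP; split => x //= [/(_ i)/andP[b1 b2]].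
move=> /(_ i)/andP[c1 c2]; case/orP: BC => h.
  by have := le_lt_trans (le_trans b2 h) c1; rewrite ltxx.
by have := le_lt_trans (le_trans c2 h) b1; rewrite ltxx.
Qed.

Lemma lebesgue_outer_box_union s : pairwise box_separated s ->
  lebesgue_outer (box_union s) = (total_volume s)%:E.
Proof.
rewrite /total_volume; elim: s => [|B s IH] /=.
  by rewrite box_union_nil big_nil lebesgue_outer0.
move=> /andP[/allP Bs /IH {}IH].
rewrite box_union_cons big_cons EFinD -IH -lebesgue_outer_box.
apply: (@measureU _ _ _ (@lebesgue_rV R d)).
- exact: measurable_box.
- exact: measurable_box_union.
- apply/seteqP; split => x //= [Bx [C Cs Cx]].
  suff : (box B `&` box C) x by rewrite box_separated_disjoint//; exact: Bs.
  by [].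
Qed.

Lemma box_volume_degenerate B : ~~ box_nondegenerate B -> box_volume B = 0.
Proof.
rewrite negb_forall => /existsP[i]; rewrite -leNgt => h.
by rewrite /box_volume (bigD1 i)//= max_l ?subr_le0// mul0r.
Qed.

Lemma box_volume_nondegenerate B : box_nondegenerate B ->
  box_volume B = \prod_(i < d) (B.2 ord0 i - B.1 ord0 i).
Proof.
move=> /forallP h; apply: eq_bigr => i _.
by rewrite max_r// subr_ge0 ltW.
Qed.

Lemma box_volume_gt0 B : box_nondegenerate B -> 0 < box_volume B.
Proof.
move=> h; rewrite box_volume_nondegenerate//; apply: prodr_gt0 => i _.
by move/forallP: h => /(_ i); rewrite subr_gt0.
Qed.

Lemma total_volume_ge0 s : 0 <= total_volume s.
Proof. by apply: sumr_ge0 => B _; exact: box_volume_ge0. Qed.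

Lemma total_volume_gt0 s : all box_nondegenerate s -> s != [::] ->
  0 < total_volume s.
Proof.
case: s => [//|B s] /= /andP[B0 _] _; rewrite /total_volume big_cons.
by rewrite ltr_pwDl ?box_volume_gt0//; exact: total_volume_ge0.
Qed.

Lemma total_volume_cut_seq f s :
  total_volume (cut_seq f s) = \sum_(B <- s) box_volume (f B).
Proof.
rewrite /total_volume big_filter big_map.
rewrite [RHS](bigID (box_nondegenerate \o f))/=.
by rewrite [X in _ = _ + X]big1 ?addr0// => B; exact: box_volume_degenerate.
Qed.

Lemma total_volume_cut i t s :
  total_volume (cut_seq (cut_below i t) s) +
  total_volume (cut_seq (cut_above i t) s) = total_volume s.
Proof.
rewrite !total_volume_cut_seq -big_split/=.
by apply: eq_bigr => B _; exact: box_volume_cut.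
Qed.

Lemma all_cut_seq f s : all box_nondegenerate (cut_seq f s).
Proof. exact: filter_all. Qed.

Lemma cut_below_separated i t B C : box_separated B C ->
  box_separated (cut_below i t B) (cut_below i t C).
Proof.
move=> /existsP[j h]; apply/existsP; exists j => /=; rewrite !mxE.
by case: eqP h => [->|//]; rewrite !ge_min => /orP[] ->; rewrite ?orbT.
Qed.

Lemma cut_above_separated i t B C : box_separated B C ->
  box_separated (cut_above i t B) (cut_above i t C).
Proof.
move=> /existsP[j h]; apply/existsP; exists j => /=; rewrite !mxE.
by case: eqP h => [->|//]; rewrite !le_max => /orP[] ->; rewrite ?orbT.
Qed.

Lemma pairwise_cut_seq f s :
  (forall B C, box_separated B C -> box_separated (f B) (f C)) ->
  pairwise box_separated s -> pairwise box_separated (cut_seq f s).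
Proof.
move=> ff ss; apply: pairwise_filter; rewrite pairwise_map.
exact: sub_pairwise ss.
Qed.

Lemma size_cut_seq f s : (size (cut_seq f s) <= size s)%N.
Proof. by rewrite size_filter -(size_map f s) count_size. Qed.

Lemma size_cut_seq_lt f s B : B \in s -> ~~ box_nondegenerate (f B) ->
  (size (cut_seq f s) < size s)%N.
Proof.
move=> Bs fB; rewrite ltn_neqAle size_cut_seq andbT size_filter.
rewrite -(size_map f s) -all_count; apply: contra fB => /allP; apply.
exact: map_f.
Qed.

Lemma cut_seq_neq0 f s B : B \in s -> box_nondegenerate (f B) ->
  cut_seq f s != [::].
Proof.
move=> Bs fB; have : f B \in cut_seq f s by rewrite mem_filter fB map_f.
by case: cut_seq.
Qed.

Lemma box_union_cut_below i t s :
  box_union (cut_seq (cut_below i t) s) `<=`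
  box_union s `&` [set x | x ord0 i <= t].
Proof.
move=> x [C /=]; rewrite mem_filter => /andP[_ /mapP[B Bs ->]].
by rewrite box_cut_below => -[Bx xt]; split => //; exists B.
Qed.

Lemma box_union_cut_above i t s :
  box_union (cut_seq (cut_above i t) s) `<=`
  box_union s `&` [set x | t < x ord0 i].
Proof.
move=> x [C /=]; rewrite mem_filter => /andP[_ /mapP[B Bs ->]].
by rewrite box_cut_above => -[Bx xt]; split => //; exists B.
Qed.

(** The volume below level [t] is continuous in [t], is 0 far down and the total volume far up, so
    the intermediate value theorem applies. *)
Lemma total_volume_cut_surj i s (v : R) : 0 <= v <= total_volume s ->
  exists t, total_volume (cut_seq (cut_below i t) s) = v.
Proof.
move=> /andP[v0 vs].
pose f t := total_volume (cut_seq (cut_below i t) s).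
have cf : continuous f.
  rewrite /f; under eq_fun do rewrite total_volume_cut_seq.
  apply: continuous_big => [x|B _]; first exact: add_continuous.
  under eq_fun do rewrite box_volume_cut_below.
  move=> t; apply: cvgMl.
  apply: (@continuous_max _ _ (cst 0)
    (fun t => Num.min (B.2 ord0 i) t - B.1 ord0 i)).
    exact: cvg_cst.
  apply: cvgB; last exact: cvg_cst.
  apply: (@continuous_min _ _ (cst (B.2 ord0 i)) id).
    exact: cvg_cst.
  exact: cvg_id.
(* [m] bounds the [i]-th side of every box. Its absolute value is used below so that the endpoints
   of the interval are in order. *)
have [m ms] : exists m, forall B, B \in s ->
    - m <= B.1 ord0 i /\ B.2 ord0 i <= m.
  elim: s {v0 vs f cf} => [|B s [m IH]]; first by exists 0.
  exists (Num.max m (Num.max (- B.1 ord0 i) (B.2 ord0 i))) => C.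
  rewrite inE => /predU1P[->|/IH[h1 h2]].
    by rewrite lerNl !le_max !lexx !orbT.
  by rewrite lerNl !le_max h2 -lerNl h1.
have f1 : f (- `|m|) = 0.
  rewrite /f total_volume_cut_seq big_seq big1// => B /ms[h _].
  rewrite box_volume_cut_below max_l ?mul0r// subr_le0 ge_min; apply/orP; right.
  by apply: le_trans h; rewrite lerN2 ler_norm.
have f2 : f `|m| = total_volume s.
  rewrite /f total_volume_cut_seq /total_volume !big_seq.
  apply: eq_bigr => B /ms[_ h].
  rewrite box_volume_cut_below min_l; first by rewrite [RHS](bigD1 i).
  by rewrite (le_trans h)// ler_norm.
have [|||c _ fc] := @IVT _ f (- `|m|) `|m| v.
- by rewrite ge0_cp//.
- exact: continuous_subspaceT.
- by rewrite f1 f2 ge_min v0/= le_max vs orbT.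
by exists c.
Qed.

End separated_boxes.

Arguments box_nondegenerate {R d} B.
Arguments box_separated {R d} B C.

(** * The Brunn-Minkowski inequality for unions of boxes *)

Section roots.
Context (R : realType).

Lemma powR_invn_exp (x : R) (d : nat) : (0 < d)%N -> 0 <= x ->
  (x `^ d%:R^-1) ^+ d = x.
Proof.
move=> d0 x0; rewrite -powR_mulrn ?powR_ge0// -powRrM mulVf ?powRr1//.
by rewrite pnatr_eq0 -lt0n.
Qed.

Lemma ler_of_expr (x y : R) (d : nat) : (0 < d)%N -> 0 <= y ->
  x ^+ d <= y ^+ d -> x <= y.
Proof.
move=> d0 y0 xy; rewrite leNgt; apply/negP => yx.
by have := ltrXn2r d y0 yx; rewrite ltNge xy -lt0n d0.
Qed.

(* Dividing by the geometric mean [p] of the [u i + w i], AM-GM bounds [x / p]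
   and [y / p] by the arithmetic means of the [u i / (u i + w i)] and of the
   [w i / (u i + w i)], which add up to 1. *)
Lemma exprD_le_prodD (d : nat) (x y : R) (u w : 'I_d -> R) : (0 < d)%N ->
  0 <= x -> 0 <= y -> (forall i, 0 < u i) -> (forall i, 0 < w i) ->
  x ^+ d = \prod_i u i -> y ^+ d = \prod_i w i ->
  (x + y) ^+ d <= \prod_i (u i + w i).
Proof.
move=> d0 x0 y0 u0 w0 xu yw.
have uw0 i : 0 < u i + w i by rewrite addr_gt0.
have P0 : 0 < \prod_i (u i + w i) by rewrite prodr_gt0.
pose p := (\prod_i (u i + w i)) `^ d%:R^-1.
have pd : p ^+ d = \prod_i (u i + w i) by rewrite powR_invn_exp// ltW.
have p0 : 0 < p by rewrite powR_gt0.
have mean (z : R) (v : 'I_d -> R) : 0 <= z -> (forall i, 0 < v i) ->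
    z ^+ d = \prod_i v i -> z / p <= (\sum_i v i / (u i + w i)) / d%:R.
  move=> z0 v0 zv; apply: (@ler_of_expr _ _ d) => //.
    rewrite divr_ge0// sumr_ge0// => i _.
    by rewrite divr_ge0// ltW.
  have [] := @leif_AGM R 'I_d predT (fun i => v i / (u i + w i)).
    by move=> i _; rewrite divr_ge0// ltW.
  rewrite card_ord => + _; apply: le_trans.
  by rewrite expr_div_n pd zv -prodf_div.
have : x / p + y / p <= 1.
  apply: (le_trans (lerD (mean x u x0 u0 xu) (mean y w y0 w0 yw))).
  rewrite -mulrDl -big_split/= (eq_bigr (fun=> 1)) => [|i _]; last first.
    by rewrite -mulrDl divff// gt_eqF.
  by rewrite big_const_ord iter_addr addr0 divff// pnatr_eq0 -lt0n.
rewrite -mulrDl ler_pdivrMr// mul1r => xyp.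
by rewrite -pd lerXn2r// nnegrE ?addr_ge0// ltW.
Qed.

End roots.

Section brunn_minkowski.
Context (R : realType) (d : nat).
Hypothesis d_gt0 : (0 < d)%N.
Local Notation boxT := ('rV[R]_d * 'rV[R]_d)%type.
Implicit Types (B C : boxT) (X Y : seq boxT) (i : 'I_d) (t : R).

Definition minkowski_sum (E F : set 'rV[R]_d) : set 'rV[R]_d :=
  [set x + y | x in E & y in F].

Lemma minkowski_sumC E F : minkowski_sum E F = minkowski_sum F E.
Proof.
by apply/seteqP; split => _ [x Ex [y Fy <-]]; exists y => //; exists x => //;
  rewrite addrC.
Qed.

Lemma minkowski_sumS E E' F F' : E `<=` E' -> F `<=` F' ->
  minkowski_sum E F `<=` minkowski_sum E' F'.
Proof.
by move=> EE FF _ [x /EE Ex [y /FF Fy <-]]; exists x => //; exists y.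
Qed.

(** A point of the larger box is the sum of the points of [B] and [C] at the same relative position
    [th i] in each coordinate. *)
Lemma box_minkowski_sum B C : box_nondegenerate B -> box_nondegenerate C ->
  box (B.1 + C.1, B.2 + C.2) `<=` minkowski_sum (box B) (box C).
Proof.
move=> /forallP B0 /forallP C0 z zBC.
pose h i := (B.2 ord0 i - B.1 ord0 i) + (C.2 ord0 i - C.1 ord0 i).
have h0 i : 0 < h i by rewrite addr_gt0 ?subr_gt0.
pose th i := (z ord0 i - (B.1 ord0 i + C.1 ord0 i)) / h i.
have th0 i : 0 < th i <= 1.
  have := zBC i; rewrite /= !mxE => /andP[z1 z2].
  rewrite divr_gt0//= ?subr_gt0// ler_pdivrMr// mul1r /h; lra.
have inb (D : boxT) : (forall i, D.1 ord0 i < D.2 ord0 i) ->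
    box D (\row_i (D.1 ord0 i + th i * (D.2 ord0 i - D.1 ord0 i))).
  move=> D0 i; rewrite mxE; have /andP[t0 t1] := th0 i.
  have D1 : 0 < D.2 ord0 i - D.1 ord0 i by rewrite subr_gt0.
  rewrite ltrDl mulr_gt0//= -lerBrDl.
  by rewrite ler_piMl// ltW.
eexists; first exact: (inb _ B0).
eexists; first exact: (inb _ C0).
apply/rowP => i; rewrite !mxE.
have -> : z ord0 i = (B.1 ord0 i + C.1 ord0 i) + th i * h i.
  by rewrite /th divfK ?gt_eqF//; lra.
by rewrite /h; ring.
Qed.

Definition brunn_minkowski_holds X Y := forall x y : R, 0 <= x -> 0 <= y ->
  x ^+ d = total_volume X -> y ^+ d = total_volume Y ->
  (((x + y) ^+ d)%:E <=
    lebesgue_outer (minkowski_sum (box_union X) (box_union Y)))%E.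

Lemma brunn_minkowski_holdsC X Y :
  brunn_minkowski_holds X Y -> brunn_minkowski_holds Y X.
Proof. by move=> H x y x0 y0 xX yY; rewrite addrC minkowski_sumC; exact: H. Qed.

(** The sum contains a box whose sides are the sums of the sides, so the claim reduces to the AM-GM
    inequality [exprD_le_prodD]. *)
Lemma brunn_minkowski_box B C : box_nondegenerate B -> box_nondegenerate C ->
  brunn_minkowski_holds [:: B] [:: C].
Proof.
move=> B0 C0 x y x0 y0; rewrite /total_volume !big_seq1 => xB yC.
have un D : box_union [:: D] = box D :> set 'rV[R]_d.
  by rewrite box_union_cons box_union_nil setU0.
rewrite !un.
apply: le_trans (le_lebesgue_outer (box_minkowski_sum B0 C0)).
have BC0 : box_nondegenerate (B.1 + C.1, B.2 + C.2).
  apply/forallP => i; rewrite !mxE.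
  by rewrite ltrD//; [move/forallP: B0|move/forallP: C0].
rewrite lebesgue_outer_box lee_fin box_volume_nondegenerate//=.
rewrite (eq_bigr (fun i =>
  (B.2 ord0 i - B.1 ord0 i) + (C.2 ord0 i - C.1 ord0 i))).
  apply: exprD_le_prodD => //.
  - by move=> i; rewrite subr_gt0; move/forallP: B0.
  - by move=> i; rewrite subr_gt0; move/forallP: C0.
  - by rewrite xB box_volume_nondegenerate.
  - by rewrite yC box_volume_nondegenerate.
by move=> i _; rewrite !mxE; ring.
Qed.

(* Hadwiger-Ohmann: cut [X] by the hyperplane between [B] and [C], and cut [Y]
   by a parallel hyperplane dividing its volume in the same proportion. The two
   partial sums lie on both sides of a third parallel hyperplane. *)
Lemma brunn_minkowski_cut n X Y B C i :
  (forall X' Y', (size X' + size Y' < n)%N -> X' != [::] -> Y' != [::] ->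
    all box_nondegenerate X' -> all box_nondegenerate Y' ->
    pairwise box_separated X' -> pairwise box_separated Y' ->
    brunn_minkowski_holds X' Y') ->
  (size X + size Y <= n)%N -> Y != [::] ->
  all box_nondegenerate X -> all box_nondegenerate Y ->
  pairwise box_separated X -> pairwise box_separated Y ->
  B \in X -> C \in X -> B.2 ord0 i <= C.1 ord0 i ->
  brunn_minkowski_holds X Y.
Proof.
move=> IH nXY Y0 ndX ndY sX sY BX CX BC x y x0 y0 xX yY.
have [/forallP ndB /forallP ndC] := (allP ndX B BX, allP ndX C CX).
(* Cutting at the upper face of [B] keeps [B] below and [C] above, while [C] vanishes below and [B]
   above: both parts of [X] are nonempty and have fewer boxes. *)
set t := B.2 ord0 i in BC.
have cB1 : box_nondegenerate (cut_below i t B).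
  apply/forallP => j /=; rewrite mxE; case: eqP => [->|_]; last exact: ndB.
  by rewrite minxx; exact: ndB.
have cB2 : ~~ box_nondegenerate (cut_above i t B).
  rewrite negb_forall; apply/existsP; exists i.
  by rewrite /= mxE eqxx -leNgt le_max lexx orbT.
have cC1 : ~~ box_nondegenerate (cut_below i t C).
  rewrite negb_forall; apply/existsP; exists i.
  by rewrite /= mxE eqxx -leNgt ge_min BC orbT.
have cC2 : box_nondegenerate (cut_above i t C).
  apply/forallP => j /=; rewrite mxE; case: eqP => [->|_]; last exact: ndC.
  by rewrite gt_max ndC/= (le_lt_trans BC)//; exact: ndC.
set X1 := cut_seq (cut_below i t) X; set X2 := cut_seq (cut_above i t) X.
have X1gt0 : 0 < total_volume X1.
  by apply: total_volume_gt0; [exact: all_cut_seq|exact: cut_seq_neq0 BX _].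
have X2gt0 : 0 < total_volume X2.
  by apply: total_volume_gt0; [exact: all_cut_seq|exact: cut_seq_neq0 CX _].
have X12 : total_volume X1 + total_volume X2 = total_volume X.
  exact: total_volume_cut.
have Xgt0 : 0 < total_volume X by rewrite -X12 addr_gt0.
have Ygt0 : 0 < total_volume Y by exact: total_volume_gt0.
pose l := total_volume X1 / total_volume X.
pose l' := total_volume X2 / total_volume X.
have l0 : 0 < l by rewrite divr_gt0.
have l'0 : 0 < l' by rewrite divr_gt0.
have ll' : l + l' = 1 by rewrite -mulrDl X12 divff// gt_eqF.
have lX : l * total_volume X = total_volume X1 by rewrite divfK// gt_eqF.
have l'X : l' * total_volume X = total_volume X2 by rewrite divfK// gt_eqF.
have [|t' Yt'] := @total_volume_cut_surj _ _ i Y (l * total_volume Y).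
  rewrite mulr_ge0 ?(ltW l0) ?(ltW Ygt0)//= ler_piMl ?(ltW Ygt0)//.
  by rewrite -ll' lerDl ltW.
set Y1 := cut_seq (cut_below i t') Y in Yt'.
set Y2 := cut_seq (cut_above i t') Y.
have Y12 : total_volume Y1 + total_volume Y2 = total_volume Y.
  exact: total_volume_cut.
have Yt2 : total_volume Y2 = l' * total_volume Y.
  have : total_volume Y = (l + l') * total_volume Y by rewrite ll' mul1r.
  by rewrite -{1}Y12 Yt' mulrDl => /addrI.
have neq0 Z : 0 < total_volume Z -> Z != [::].
  by apply: contraTneq => ->; rewrite /total_volume big_nil ltxx.
(* Both volumes are scaled by the same [m], hence both roots by the [d]-th root of [m], and the
   induction hypothesis yields the fraction [m] of the desired bound. *)
have part X' Y' m : 0 < m -> (size X' < size X)%N -> (size Y' <= size Y)%N ->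
    total_volume X' = m * total_volume X ->
    total_volume Y' = m * total_volume Y ->
    all box_nondegenerate X' -> all box_nondegenerate Y' ->
    pairwise box_separated X' -> pairwise box_separated Y' ->
    ((m * (x + y) ^+ d)%:E <=
     lebesgue_outer (minkowski_sum (box_union X') (box_union Y')))%E.
  move=> m0 sX' sY' vX' vY' ndX' ndY' seX' seY'.
  rewrite -{1}(powR_invn_exp d_gt0 (ltW m0)) -exprMn mulrDr.
  apply: IH => //.
  - by rewrite (leq_trans _ nXY)// -addSn leq_add.
  - by apply: neq0; rewrite vX' mulr_gt0.
  - by apply: neq0; rewrite vY' mulr_gt0.
  - by rewrite mulr_ge0 ?powR_ge0.
  - by rewrite mulr_ge0 ?powR_ge0.
  - by rewrite exprMn powR_invn_exp ?(ltW m0)// xX vX'.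
  - by rewrite exprMn powR_invn_exp ?(ltW m0)// yY vY'.
rewrite -[(x + y) ^+ d]mul1r -ll' mulrDl EFinD.
apply: le_trans (lebesgue_outer_half_space i (t + t') _).
apply: leeD.
  apply: (@le_trans _ _ (lebesgue_outer
    (minkowski_sum (box_union X1) (box_union Y1)))).
    apply: part => //; rewrite ?all_cut_seq ?size_cut_seq//.
    - exact: size_cut_seq_lt CX _.
    - by apply: pairwise_cut_seq => //; exact: cut_below_separated.
    - by apply: pairwise_cut_seq => //; exact: cut_below_separated.
  apply: le_lebesgue_outer => _ [u /box_union_cut_below[Xu ut]
    [w /box_union_cut_below[Yw wt] <-]].
  by split; [exists u => //; exists w|rewrite /= mxE lerD].
apply: (@le_trans _ _ (lebesgue_outer
  (minkowski_sum (box_union X2) (box_union Y2)))).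
  apply: part => //; rewrite ?all_cut_seq ?size_cut_seq//.
  - exact: size_cut_seq_lt BX _.
  - by apply: pairwise_cut_seq => //; exact: cut_above_separated.
  - by apply: pairwise_cut_seq => //; exact: cut_above_separated.
apply: le_lebesgue_outer => _ [u /box_union_cut_above[Xu ut]
  [w /box_union_cut_above[Yw wt] <-]].
by split; [exists u => //; exists w|rewrite /= mxE ltrD].
Qed.

(** Strong induction on the total number of boxes. Two boxes in one list allow a cut, the lists
    being interchangeable; otherwise each list is a single box. *)
Lemma brunn_minkowski_boxes X Y : X != [::] -> Y != [::] ->
  all box_nondegenerate X -> all box_nondegenerate Y ->
  pairwise box_separated X -> pairwise box_separated Y ->
  brunn_minkowski_holds X Y.
Proof.
have [n] := ubnP (size X + size Y); elim: n X Y => // n IH X Y.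
rewrite ltnS => nXY X0 Y0 ndX ndY sX sY.
have cut (Z W : seq boxT) B C : (size Z + size W <= n)%N -> W != [::] ->
    all box_nondegenerate Z -> all box_nondegenerate W ->
    pairwise box_separated Z -> pairwise box_separated W ->
    B \in Z -> C \in Z -> box_separated B C -> brunn_minkowski_holds Z W.
  move=> nZW W0 ndZ ndW sZ sW BZ CZ /existsP[i /orP[BC|CB]].
    exact: (@brunn_minkowski_cut n Z W B C i).
  exact: (@brunn_minkowski_cut n Z W C B i).
case: X => [//|B [|C X]] in nXY X0 ndX sX *; last first.
  apply: (cut _ _ B C) => //; rewrite ?inE ?eqxx ?orbT//.
  by move: sX => /= /andP[/andP[]].
case: Y => [//|B' [|C' Y]] in nXY Y0 ndY sY *.
  apply: brunn_minkowski_box.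
  - by move: ndX => /= /andP[].
  - by move: ndY => /= /andP[].
apply: brunn_minkowski_holdsC.
apply: (cut _ _ B' C') => //; rewrite ?inE ?eqxx ?orbT//.
  by rewrite addnC.
by move: sY => /= /andP[/andP[]].
Qed.

End brunn_minkowski.

(** * Open sets *)

Section open_sets.
Context (R : realType) (d : nat).
Implicit Types (U V : set 'rV[R]_d) (n : nat).

Lemma open_rVP U : open U <-> forall x, U x -> exists2 r : R, 0 < r &
  forall y : 'rV[R]_d, (forall i, `|y ord0 i - x ord0 i| < r) -> U y.
Proof.
rewrite openE; split=> [oU x /oU|oU x /oU[r r0 rU]].
  move=> /nbhs_ballP[r /= r0 rU]; exists r => // y yx.
  apply: rU; split=> // i j.
  by rewrite /ball /= distrC (ord1 i).
apply/nbhs_ballP; exists r => //= y [_ yx]; apply: rU => i.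
by have := yx ord0 i; rewrite /ball /= distrC.
Qed.

(** Level [n] tiles the cube from [-n] to [n] with cells of side [1 / 2 ^ n], so one parameter
    controls both extent and mesh, and each level is finite. *)
Definition dyadic_cell n (z : {ffun 'I_d -> 'I_((n * 2 ^ n).*2)}) :
    'rV[R]_d * 'rV[R]_d :=
  (\row_i ((z i)%:R / 2 ^+ n - n%:R), \row_i ((z i).+1%:R / 2 ^+ n - n%:R)).

Definition dyadic_cells n U : seq ('rV[R]_d * 'rV[R]_d) :=
  [seq dyadic_cell z | z <- enum {ffun 'I_d -> 'I_((n * 2 ^ n).*2)} &
                       `[< box (dyadic_cell z) `<=` U >]].

Lemma box_dyadic_cell n (z : {ffun 'I_d -> 'I_((n * 2 ^ n).*2)}) x :
  box (dyadic_cell z) x <->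
  forall i, (z i)%:R < 2 ^+ n * (x ord0 i + n%:R) <= (z i).+1%:R.
Proof.
split=> h i; have := h i; rewrite /= !mxE ltrBlDr lerBrDr;
  by rewrite ltr_pdivrMr ?ler_pdivlMr ?exprn_gt0// ![_ * 2 ^+ n]mulrC.
Qed.

Lemma exists_ceil_nat (u : R) (m : nat) : 0 < u <= m%:R ->
  exists j : 'I_m, j%:R < u <= j.+1%:R.
Proof.
move=> /andP[u0]; elim: m => [|m IH] um.
  by have := lt_le_trans u0 um; rewrite ltxx.
have [/IH[j ju]|mu] := leP u m%:R.
  by exists (widen_ord (leqnSn m) j).
by exists ord_max; rewrite /= mu um.
Qed.

Lemma exists_dyadic_cell n (x : 'rV[R]_d) :
  (forall i, - n%:R < x ord0 i <= n%:R) ->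
  exists z : {ffun 'I_d -> 'I_((n * 2 ^ n).*2)}, box (dyadic_cell z) x.
Proof.
move=> xn.
have /choice[f fP] : forall i, exists j : 'I_((n * 2 ^ n).*2),
    j%:R < 2 ^+ n * (x ord0 i + n%:R) <= j.+1%:R.
  move=> i; apply: exists_ceil_nat; have /andP[x1 x2] := xn i.
  rewrite mulr_gt0 ?exprn_gt0//=; last by rewrite -ltrBlDr sub0r.
  rewrite -muln2 natrM natrM natrX mulrAC [_ * 2 ^+ n]mulrC.
  rewrite ler_pM2l ?exprn_gt0//.
  by rewrite mulr_natr mulr2n lerD2r.
by exists (finfun f); apply/box_dyadic_cell => i; rewrite ffunE; exact: fP.
Qed.

Lemma dyadic_cells_nondegenerate n U : all box_nondegenerate (dyadic_cells n U).
Proof.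
apply/allP => _ /mapP[z _ ->]; apply/forallP => i; rewrite !mxE.
by rewrite ltrD2r ltr_pM2r ?invr_gt0 ?exprn_gt0// ltr_nat.
Qed.

Lemma dyadic_cells_separated n U : pairwise box_separated (dyadic_cells n U).
Proof.
rewrite pairwise_map; apply: pairwise_filter.
apply: (@sub_pairwise _ [rel x y | x != y]); last first.
  by rewrite -uniq_pairwise enum_uniq.
move=> z w /= zw; have [i zwi] : exists i, z i != w i.
  apply/existsP; rewrite -negb_forall; apply: contra zw => /forallP h.
  by apply/eqP/ffunP => i; exact/eqP.
apply/existsP; exists i; rewrite /= !mxE !lerD2r.
rewrite !ler_pM2r ?invr_gt0 ?exprn_gt0// !ler_nat.
by move: zwi; rewrite -val_eqE neq_ltn.
Qed.

Lemma dyadic_cells_sub n U : box_union (dyadic_cells n U) `<=` U.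
Proof.
move=> x [_ /mapP[z + ->]].
by rewrite mem_filter => /andP[/asboolP + _]; exact.
Qed.

Lemma in_dyadic_cells n U x (z : {ffun 'I_d -> 'I_((n * 2 ^ n).*2)}) :
  box (dyadic_cell z) x -> box (dyadic_cell z) `<=` U ->
  box_union (dyadic_cells n U) x.
Proof.
move=> zx zU; exists (dyadic_cell z) => //; apply/mapP; exists z => //.
by rewrite mem_filter mem_enum andbT; exact/asboolP.
Qed.

(** The cell of level [n.+1] through a point lies inside the cell of level [n] through it, hence in
    [U]. *)
Lemma dyadic_cells_nondecreasing U :
  nondecreasing_seq (fun n => box_union (dyadic_cells n U)).
Proof.
apply/nondecreasing_seqP => n; apply/subsetPset => x [_ /mapP[z + ->]].
rewrite mem_filter => /andP[/asboolP zU _] zx.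
have /box_dyadic_cell zx' := zx.
have xn i : - n.+1%:R < x ord0 i <= n.+1%:R.
  have /andP[z1 z2] := zx' i; apply/andP; split.
    have : 0 < 2 ^+ n * (x ord0 i + n%:R) by rewrite (le_lt_trans _ z1).
    rewrite pmulr_rgt0 ?exprn_gt0// => h; rewrite -natr1; lra.
  have : 2 ^+ n * (x ord0 i + n%:R) <= 2 ^+ n * (n%:R + n%:R).
    rewrite (le_trans z2)// -natrD addnn -natrX -natrM ler_nat.
    by rewrite (leq_trans (ltn_ord (z i)))// -doubleMr mulnC.
  rewrite ler_pM2l ?exprn_gt0// => h; rewrite -natr1; lra.
have [w wx] := exists_dyadic_cell xn; apply: (in_dyadic_cells wx).
apply: subset_trans zU => y /box_dyadic_cell wy.
apply/box_dyadic_cell => i.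
have /andP[z1 z2] := zx' i.
have /box_dyadic_cell/(_ i)/andP[w1 w2] := wx.
have /andP[y1 y2] := wy i.
(* The rescaled coordinate doubles because the mesh is halved, and shifts by [2 ^ n.+1] because the
   corner moves by one unit. *)
have E (u : 'rV[R]_d) : 2 ^+ n.+1 * (u ord0 i + n.+1%:R) =
    2 * (2 ^+ n * (u ord0 i + n%:R)) + (2 ^ n.+1)%:R.
  by rewrite natrX exprS -natr1; ring.
rewrite !E in w1 w2 y1 y2.
move: (nat_of_ord (z i)) (nat_of_ord (w i)) z1 z2 w1 w2 y1 y2 => a b.
move=> z1 z2 w1 w2 y1 y2.
(* Strict inequalities between integers gain a unit, so the fine interval lies entirely within the
   coarse one. *)
have h1 : (a.*2 + 2 ^ n.+1 <= b)%N.
  rewrite -ltnS -(ltr_nat R) natrD -muln2 natrM; lra.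
have h2 : (b.+1 <= a.+1.*2 + 2 ^ n.+1)%N.
  rewrite -(ltr_nat R) natrD -muln2 natrM; lra.
move: h1 h2; rewrite -!(ler_nat R) !natrD -!muln2 !natrM => h1 h2.
by apply/andP; split; lra.
Qed.

Lemma bigcup_dyadic_cells U : open U ->
  \bigcup_n box_union (dyadic_cells n U) = U.
Proof.
move=> oU; apply/seteqP; split => [x [n _]|x Ux]; first exact: dyadic_cells_sub.
have [r r0 rU] := (open_rVP U).1 oU x Ux.
(* One [n] above [b] both puts [x] in the cube of level [n] and makes the mesh smaller than [r]. *)
pose b := \sum_i `|x ord0 i| + r^-1.
have b1 : 0 <= \sum_i `|x ord0 i| by rewrite sumr_ge0.
have b0 : 0 <= b by rewrite addr_ge0// invr_ge0 ltW.
have bn := archi_boundP b0; set n := Num.bound b in bn.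
exists n => //.
have xn i : - n%:R < x ord0 i <= n%:R.
  have : `|x ord0 i| < n%:R.
    apply: le_lt_trans bn; rewrite /b (bigD1 i)//= -addrA lerDl addr_ge0//.
      by rewrite sumr_ge0.
    by rewrite invr_ge0 ltW.
  by rewrite ltr_norml => /andP[-> /ltW ->].
have [z zx] := exists_dyadic_cell xn; apply: (in_dyadic_cells zx) => y.
move=> /box_dyadic_cell zy; move: zx => /box_dyadic_cell zx; apply: rU => i.
have /andP[x1 x2] := zx i; have /andP[y1 y2] := zy i.
have n2 : r^-1 < 2 ^+ n.
  rewrite (@lt_le_trans _ _ n%:R)//.
    by rewrite (le_lt_trans _ bn)// lerDr.
  by rewrite -natrX ler_nat ltnW// ltn_expl.
have rn : 1 < 2 ^+ n * r by rewrite -ltr_pdivrMr// div1r.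
have e : 2 ^+ n * `|y ord0 i - x ord0 i| < 1.
  rewrite -[X in X * _](@ger0_norm _ (2 ^+ n)) ?exprn_ge0// -normrM.
  rewrite -natr1 in x2 y2.
  rewrite ltr_norml mulrBr; apply/andP; split; lra.
by have := lt_trans e rn; rewrite ltr_pM2l ?exprn_gt0.
Qed.

Lemma measurable_open_rV U : open U ->
  measurable (U : set (caratheodory_type (@lebesgue_outer R d))).
Proof.
move=> /bigcup_dyadic_cells <-; apply: bigcup_measurable => n _.
exact: measurable_box_union.
Qed.

(** Continuity from below along the unions of dyadic cells, which exhaust [U]; this includes the
    case of infinite measure. *)
Lemma open_rV_approx U (c : R) : open U -> (c%:E < lebesgue_outer U)%E ->
  exists s, [/\ all box_nondegenerate s, pairwise box_separated s,
    box_union s `<=` U & c < total_volume s].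
Proof.
move=> oU cU.
suff [n cn] : exists n, c < total_volume (dyadic_cells n U).
  exists (dyadic_cells n U); split => //.
  - exact: dyadic_cells_nondegenerate.
  - exact: dyadic_cells_separated.
  - exact: dyadic_cells_sub.
apply: contrapT => /forallNP nc.
have mU := measurable_open_rV oU.
have := @nondecreasing_cvg_mu _ _ _ (@lebesgue_rV R d)
  (fun n => box_union (dyadic_cells n U)).
rewrite bigcup_dyadic_cells// => /(_ _ mU (@dyadic_cells_nondecreasing U)).
move=> /(_ (fun n => measurable_box_union _)) /cvg_lim lU.
have : (lebesgue_outer U <= c%:E)%E.
  rewrite -[leLHS]lU//; apply: lime_le.
    apply: ereal_nondecreasing_is_cvgn => m n mn; apply: le_lebesgue_outer.
    exact/subsetPset/dyadic_cells_nondecreasing.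
  apply: nearW => n /=; rewrite /lebesgue_rV lebesgue_outer_box_union.
    by rewrite lee_fin leNgt; exact/negP.
  exact: dyadic_cells_separated.
by rewrite leNgt cU.
Qed.

(** The strict bounds leave room for finite unions of boxes inside [U] and [V] with volumes still
    above [x ^+ d] and [y ^+ d]. *)
Lemma brunn_minkowski_open U V (x y : R) : (0 < d)%N ->
  open U -> open V -> 0 <= x -> 0 <= y ->
  ((x ^+ d)%:E < lebesgue_outer U)%E -> ((y ^+ d)%:E < lebesgue_outer V)%E ->
  (((x + y) ^+ d)%:E <= lebesgue_outer (minkowski_sum U V))%E.
Proof.
move=> d0 oU oV x0 y0 /(open_rV_approx oU)[s [nds ss sU xs]].
move=> /(open_rV_approx oV)[t [ndt st tV yt]].
have neq0 (z : R) (w : seq ('rV[R]_d * 'rV[R]_d)) :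
    0 <= z -> z ^+ d < total_volume w -> w != [::].
  move=> z0; apply: contraTneq => ->; rewrite /total_volume big_nil -leNgt.
  exact: exprn_ge0.
apply: le_trans (le_lebesgue_outer (minkowski_sumS sU tV)).
apply: le_trans (brunn_minkowski_boxes d0 (neq0 _ _ x0 xs) (neq0 _ _ y0 yt)
  nds ndt ss st (powR_ge0 (total_volume s) d%:R^-1)
  (powR_ge0 (total_volume t) d%:R^-1) _ _);
  rewrite ?powR_invn_exp ?total_volume_ge0//.
rewrite lee_fin lerXn2r ?nnegrE ?addr_ge0 ?powR_ge0//.
by apply: lerD; apply: (@ler_of_expr _ _ _ d) => //;
  rewrite ?powR_ge0// powR_invn_exp ?total_volume_ge0// ltW.
Qed.

End open_sets.

(** * Thickenings with respect to a norm *)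

Section norms.
Context (R : realType) (d : nat) (N : 'rV[R]_d -> R).
Hypothesis normN : is_norm N.
Implicit Types (X : set 'rV[R]_d) (x y p : 'rV[R]_d) (r : R).

Lemma is_norm0 : N 0 = 0.
Proof. by rewrite -(scale0r 0) (norm_homogeneous normN) normr0 mul0r. Qed.

Lemma is_normN x : N (- x) = N x.
Proof. by rewrite -scaleN1r (norm_homogeneous normN) normrN1 mul1r. Qed.

Lemma is_norm_ge0 x : 0 <= N x.
Proof.
have := norm_triangle normN x (- x); rewrite subrr is_norm0 is_normN => h; lra.
Qed.

Lemma is_norm_sum (I : Type) (s : seq I) (F : I -> 'rV[R]_d) :
  N (\sum_(i <- s) F i) <= \sum_(i <- s) N (F i).
Proof.
elim: s => [|i s IH]; first by rewrite !big_nil is_norm0.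
by rewrite !big_cons (le_trans (norm_triangle normN _ _))// lerD2l.
Qed.

(** By expansion in the standard basis. The summand 1 in the constant keeps it positive even in
    dimension 0. *)
Lemma is_norm_upper : exists2 C : R, 0 < C &
  forall x r, 0 <= r -> (forall i, `|x ord0 i| <= r) -> N x <= C * r.
Proof.
have S0 : 0 <= \sum_(i < d) N (delta_mx ord0 i).
  by apply: sumr_ge0 => i _; exact: is_norm_ge0.
exists (\sum_(i < d) N (delta_mx ord0 i) + 1); first by rewrite ltr_wpDl.
move=> x r r0 xr; rewrite [x in leLHS]row_sum_delta.
apply: (le_trans (is_norm_sum _ _)).
apply: (@le_trans _ _ ((\sum_(i < d) N (delta_mx ord0 i)) * r)); last first.
  by rewrite ler_wpM2r// lerDl.
rewrite mulr_suml; apply: ler_sum => i _.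
by rewrite (norm_homogeneous normN) mulrC ler_wpM2l// is_norm_ge0.
Qed.

Lemma is_norm_near x (e : R) : 0 < e -> exists2 r : R, 0 < r &
  forall y, (forall i, `|y ord0 i - x ord0 i| < r) -> N (y - x) < e.
Proof.
move=> e0; have [C C0 CN] := is_norm_upper.
exists (e / 2 / C); first by rewrite !divr_gt0.
move=> y yx; apply: (@le_lt_trans _ _ (C * (e / 2 / C))).
  apply: CN; first by rewrite !divr_ge0// ltW.
  by move=> i; rewrite !mxE ltW.
rewrite mulrC divfK ?gt_eqF//; lra.
Qed.

Lemma is_norm_continuous : continuous N.
Proof.
move=> x; have fx : Filter (nbhs x) by exact: nbhs_filter.
apply/(@cvgrPdist_lt _ _ _ (nbhs x) fx) => e e0; apply/nbhs_ballP.
have [r r0 rN] := is_norm_near x e0.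
exists r => //= y [_ yx].
have yxe : N (y - x) < e.
  by apply: rN => i; have := yx ord0 i; rewrite /ball /= distrC.
have := norm_triangle normN (y - x) x.
have := norm_triangle normN (x - y) y.
rewrite -[N (x - y)]is_normN opprB !subrK => h1 h2.
rewrite ltr_norml; apply/andP; split; lra.
Qed.

Lemma le_coord_norm x (i : 'I_d) : `|x ord0 i| <= `|x|.
Proof.
by rewrite [leRHS]/Num.norm /= mx_normrE; apply: (le_bigmax _ _ (ord0, i)).
Qed.

(** [N] attains its minimum on the compact sup-norm unit sphere, where it is positive by
    definiteness; homogeneity extends the bound to all vectors. The sphere is empty only if 0 is the
    sole vector. *)
Lemma is_norm_lower : exists2 c : R, 0 < c &
  forall x i, `|x ord0 i| <= c * N x.
Proof.
pose S : set 'rV[R]_d := [set x | `|x| = 1].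
have S_scale x : x != 0 -> S (`|x|^-1 *: x).
  by move=> x0; rewrite /S /= normrZ normfV normr_id mulVf// normr_eq0.
have cS : compact S.
  apply: bounded_closed_compact.
    by exists 1; split => // M M1 x; rewrite /S /= => ->; exact: ltW.
  rewrite /S (_ : mkset _ = Num.norm @^-1` [set 1])//.
  apply: preimage_closed; last exact: closed_eq.
  by move=> x _; exact: norm_continuous.
have [S0|/set0P/negP/negPn/eqP S0] := pselect (S !=set0); last first.
  exists 1 => // x i; have [->|/S_scale] := eqVneq x 0; last by rewrite S0.
  by rewrite mxE normr0 mul1r is_norm_ge0.
have [a] := EVT_min_rV S0 cS (continuous_subspaceT is_norm_continuous).
rewrite inE => Sa amin.
have Na : 0 < N a.
  rewrite lt0r is_norm_ge0 andbT; apply/eqP => /(norm_definite normN) a0.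
  by move: Sa; rewrite /S /= a0 normr0 => /esym/eqP; rewrite oner_eq0.
exists (N a)^-1; first by rewrite invr_gt0.
move=> x i; have [->|x0] := eqVneq x 0.
  by rewrite mxE normr0 is_norm0 mulr0.
apply: (le_trans (le_coord_norm x i)).
have := amin (`|x|^-1 *: x); rewrite inE => /(_ (S_scale _ x0)).
rewrite (norm_homogeneous normN) normfV normr_id.
rewrite ler_pdivlMl ?normr_gt0// ler_pdivlMl//.
by rewrite mulrC.
Qed.

(** By symmetry of the norm this is the Minkowski sum of [X] and the ball of radius [r]. In this
    form, membership of [p] says that the ball around [p] meets [X], which is what gets counted. *)
Definition thickening X r : set 'rV[R]_d :=
  [set p | X `&` norm_ball N p r !=set0].

Lemma open_thickening X r : open (thickening X r).
Proof.
apply/open_rVP => p [x [Xx xp]]; rewrite /norm_ball /= in xp.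
have xp0 : 0 < r - N (x - p) by rewrite subr_gt0.
have [s s0 sN] := is_norm_near p xp0.
exists s => // y yp; exists x; split => //; rewrite /norm_ball /=.
have -> : x - y = (x - p) + - (y - p) by rewrite opprB addrA subrK.
apply: le_lt_trans (norm_triangle normN _ _) _.
by rewrite is_normN -ltrBrDl; exact: sN.
Qed.

Lemma sub_thickening X r : 0 < r -> X `<=` thickening X r.
Proof.
move=> r0 x Xx; exists x; split => //.
by rewrite /norm_ball /= subrr is_norm0.
Qed.

Lemma norm_ball_thickening r : norm_ball N 0 r = thickening [set 0] r.
Proof.
apply/seteqP; split=> p; rewrite /norm_ball /=.
  by move=> pr; exists 0; split => //; rewrite /norm_ball /= -is_normN opprB.
by move=> [_ [->]]; rewrite /norm_ball /= -is_normN opprB.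
Qed.

Lemma thickeningD X r s :
  minkowski_sum (thickening X r) (norm_ball N 0 s) `<=` thickening X (r + s).
Proof.
move=> _ [p [x [Xx xp]] [y ys <-]]; exists x; split => //.
rewrite /norm_ball /= subr0 in xp ys *.
rewrite opprD addrA (le_lt_trans (norm_triangle normN _ _))//.
by rewrite is_normN ltrD.
Qed.

Lemma lebesgue_outer_norm_ball r : 0 < r ->
  ((r ^+ d)%:E * lebesgue_outer (norm_ball N 0 1) <=
   lebesgue_outer (norm_ball N 0 r))%E.
Proof.
move=> r0; apply: le_trans (lebesgue_outer_scale _ r0) _.
apply: le_lebesgue_outer => x /=; rewrite /norm_ball /= !subr0.
rewrite (norm_homogeneous normN) gtr0_norm ?invr_gt0//.
by rewrite ltr_pdivrMl// mulr1.
Qed.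

(** [X] may be non-measurable, so part of the radius [e] is spent on making it open and the rest is
    the second summand. A factor [th] below 1 makes the bounds strict, and then tends to 1. *)
Lemma brunn_minkowski_thickening X (a b e : R) : (0 < d)%N ->
  0 < a -> 0 < b -> 0 < e ->
  ((a ^+ d)%:E <= lebesgue_outer X)%E ->
  ((b ^+ d)%:E <= lebesgue_outer (norm_ball N 0 1))%E ->
  (((a + e * b) ^+ d)%:E <= lebesgue_outer (thickening X e))%E.
Proof.
move=> d0 a0 b0 e0 aX bB.
have step (th : R) : 0 < th < 1 ->
    (((th * (a + e * b)) ^+ d)%:E <= lebesgue_outer (thickening X e))%E.
  move=> /andP[th0 th1].
  (* As [th'] lies strictly between [th] and 1, some radius is left to open [X], while the ball of
     radius [th' * e] still has measure above [(th * e * b) ^+ d]. *)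
  pose th' := (1 + th) / 2.
  have th'1 : 0 < 1 - th' by rewrite /th'; lra.
  have th'0 : 0 < th' by rewrite /th'; lra.
  have -> : th * (a + e * b) = th * a + th * e * b by ring.
  have -> : e = (1 - th') * e + th' * e by rewrite -mulrDl subrK mul1r.
  rewrite -[in leLHS]mulrDl subrK mul1r.
  apply: le_trans (le_lebesgue_outer (@thickeningD X _ _)).
  apply: brunn_minkowski_open => //.
  - exact: open_thickening.
  - by rewrite norm_ball_thickening; exact: open_thickening.
  - by rewrite mulr_ge0// ltW.
  - by rewrite !mulr_ge0// ltW.
  - apply: (@lt_le_trans _ _ (a ^+ d)%:E).
      rewrite lte_fin ltrXn2r -?lt0n ?mulr_ge0 ?ltW//.
      by rewrite gtr_pMl.
    apply: (le_trans aX); apply: le_lebesgue_outer; apply: sub_thickening.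
    by rewrite mulr_gt0.
  - have t'e : 0 < th' * e by rewrite mulr_gt0.
    apply: lt_le_trans (lebesgue_outer_norm_ball t'e).
    apply: (@lt_le_trans _ _ (((th' * e) ^+ d)%:E * (b ^+ d)%:E)%E).
      rewrite -EFinM lte_fin -exprMn ltrXn2r -?lt0n//.
        by rewrite !mulr_ge0 ?ltW.
      rewrite ltr_pM2r// ltr_pM2r// /th'; lra.
    by rewrite lee_pmul2l// lte_fin exprn_gt0.
case E : (lebesgue_outer (thickening X e)) => [m| |].
- rewrite lee_fin leNgt; apply/negP => mlt.
  have m0 : 0 <= m by rewrite -lee_fin -E lebesgue_outer_ge0.
  pose s := a + e * b; pose q := m `^ d%:R^-1.
  have s0 : 0 < s by rewrite addr_gt0// mulr_gt0.
  have q0 : 0 <= q by exact: powR_ge0.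
  have qs : q < s.
    rewrite ltNge; apply/negP => sq; move: mlt; rewrite ltNge => /negP; apply.
    by rewrite -(powR_invn_exp d0 m0) lerXn2r ?nnegrE ?powR_ge0// -/s ltW.
  (* The ratio halfway between [q / s] and 1 would give [(q + s) / 2 <= q], contradicting
     [q < s]. *)
  have th : 0 < (q / s + 1) / 2 < 1.
    have h1 : q / s < 1 by rewrite ltr_pdivrMr ?mul1r.
    have h2 : 0 <= q / s by rewrite divr_ge0// ltW.
    by apply/andP; split; lra.
  have := step _ th; rewrite E lee_fin -/s.
  have -> : (q / s + 1) / 2 * s = (q + s) / 2.
    by field; rewrite gt_eqF.
  rewrite -(powR_invn_exp d0 m0) -/q => /(ler_of_expr d0 q0) h; lra.
- by rewrite leey.
- by have := lebesgue_outer_ge0 (thickening X e); rewrite E.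
Qed.

End norms.

(** * Counting members of a partition *)

Section counting.
Context (R : realType) (d : nat).
Local Notation mu := (@lebesgue_outer R d).
Local Notation cara := (caratheodory_type mu).

Lemma card_le_filter (T : choiceType) (s : seq T) (a : pred T) (k : nat) :
  uniq s -> (k <= count a s)%N -> (`I_k #<= [set x | x \in s /\ a x])%card.
Proof.
move=> us; rewrite -size_filter => ks.
case: k ks => [|k] ks; first by rewrite II0 card_ge0.
have x0 : T by case: [seq x <- s | a x] ks.
have inj : {in `I_k.+1 &, injective (nth x0 [seq x <- s | a x])}.
  move=> i j; rewrite !inE /= => ik jk /eqP.
  by rewrite nth_uniq ?filter_uniq ?(leq_trans _ ks)// => /eqP.
rewrite -(card_le_eql (inj_card_eq inj)); apply: subset_card_le.
move=> _ [i /= ik <-].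
have : nth x0 [seq x <- s | a x] i \in [seq x <- s | a x].
  by apply: mem_nth; exact: leq_trans ks.
by rewrite mem_filter => /andP[].
Qed.

Lemma finite_of_card_nle (T : Type) (A : set T) (k : nat) :
  ~ (`I_k #<= A)%card -> finite_set A.
Proof.
move=> kA; apply: contrapT => /infiniteP nA; apply: kA.
exact: card_le_trans (card_leT _) nA.
Qed.

(** Members of the partition may be non-measurable, so their total measure in a cube is bounded
    below by subadditivity alone. *)
Lemma lebesgue_outer_bigcup_seq (I : eqType) (s : seq I)
    (X : I -> set 'rV[R]_d) :
  (mu (\bigcup_(i in [set` s]) X i) <= \sum_(i <- s) mu (X i))%E.
Proof.
elim: s => [|i s IH].
  rewrite big_nil (_ : \bigcup_(i in _) _ = set0) ?lebesgue_outer0//.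
  by apply/seteqP; split => x // [].
rewrite big_cons; apply: le_trans (leeD2l _ IH).
apply: le_trans (outer_measureU2 _ _ _); apply: le_lebesgue_outer.
by move=> x [j /=]; rewrite inE => /predU1P[->|js] Xx; [left|right; exists j].
Qed.

(** Both sides are integrals: the sum of the indicators of the [U i] is at most [m] everywhere and
    vanishes off [T]. *)
Lemma lebesgue_outer_multiplicity (I : eqType) (s : seq I)
    (U : I -> set 'rV[R]_d) (T : set 'rV[R]_d) (m : nat) :
  (forall i, open (U i)) -> measurable (T : set cara) ->
  (forall i, U i `<=` T) ->
  (forall p, (count (fun i => p \in U i) s <= m)%N) ->
  (\sum_(i <- s) mu (U i) <= m%:R%:E * mu T)%E.
Proof.
move=> oU mT UT Um.
have mU i : measurable (U i : set cara) by exact: measurable_open_rV.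
pose nu : {measure set cara -> \bar R} := @lebesgue_rV R d.
have -> : (\sum_(i <- s) mu (U i) =
    \int[nu]_p \sum_(i <- s) (\1_(U i : set cara) p)%:E)%E.
  rewrite ge0_integral_sum//; last first.
    by move=> i; apply/measurable_EFinP; exact: measurable_indic.
  by apply: eq_bigr => i _; rewrite integral_indic// setIT.
have -> : (m%:R%:E * mu T = \int[nu]_p (m%:R%:E * (\1_(T : set cara) p)%:E))%E.
  rewrite ge0_integralZl_EFin//.
  - by rewrite integral_indic// setIT.
  - by apply/measurable_EFinP; exact: measurable_indic.
apply: ge0_le_integral => //.
- by move=> p _; apply: sume_ge0.
- apply: emeasurable_sum => i.
  by apply/measurable_EFinP; exact: measurable_indic.
- apply: measurable_funeM.
  by apply/measurable_EFinP; exact: measurable_indic.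
move=> p _; rewrite -EFinM sumEFin lee_fin.
have -> : \sum_(i <- s) \1_(U i) p = (count (fun i => p \in U i) s)%:R :> R.
  rewrite -sum1_count [in RHS]big_mkcond natr_sum; apply: eq_bigr => i _.
  by rewrite indicE; case: ifP.
rewrite indicE; case: (boolP (p \in T)) => pT.
  by rewrite mulr1 ler_nat.
rewrite mulr0 lern0 -leqn0 leqNgt -has_count -all_predC.
apply/allP => i _ /=; apply: contra pT; rewrite !inE; exact: UT.
Qed.

End counting.

(** * Elementary estimates for the limit of large cubes *)

Lemma bernoulli (R : realType) (u : R) (n : nat) : 0 <= u <= 1 ->
  1 - n%:R * u <= (1 - u) ^+ n.
Proof.
move=> /andP[u0 u1]; elim: n => [|n IH]; first by rewrite mul0r subr0 expr0.
rewrite exprS; apply: (@le_trans _ _ ((1 - u) * (1 - n%:R * u))).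
  have : 0 <= n%:R * u * u by rewrite !mulr_ge0.
  rewrite -natr1; nra.
by rewrite ler_wpM2l// subr_ge0.
Qed.

(* Bernoulli: [(n / (n + C)) ^ d >= 1 - d C / (n + C)], which tends to 1. *)
Lemma le_of_scaled_le (R : realType) (d n0 : nat) (D K C : R) :
  0 <= D -> 0 <= C ->
  (forall n, (n0 <= n)%N -> (0 < n)%N ->
    D * n%:R ^+ d <= K * (n%:R + C) ^+ d) ->
  D <= K.
Proof.
move=> D0 C0 H; rewrite leNgt; apply/negP => KD.
have DK : 0 < D - K by rewrite subr_gt0.
(* For [n] above [b] the Bernoulli loss [D * d * C / (n + C)] is smaller than [D - K]. *)
pose b := D * d%:R * C / (D - K).
have b0 : 0 <= b by rewrite !mulr_ge0// invr_ge0 ltW.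
have bn := archi_boundP b0.
pose n := (maxn n0 (Num.bound b)).+1.
have n0n : (n0 <= n)%N by rewrite leqW// leq_maxl.
have {}bn : b < n%:R.
  by rewrite (lt_le_trans bn)// ler_nat leqW// leq_maxr.
have nC : 0 < n%:R + C by rewrite ltr_wpDr// ltr0n.
have := H n n0n (ltn0Sn _).
rewrite -ler_pdivrMr ?exprn_gt0// -mulrA -expr_div_n.
pose u := C / (n%:R + C).
have -> : n%:R / (n%:R + C) = 1 - u.
  by rewrite /u; field; rewrite gt_eqF.
have u0 : 0 <= u by rewrite divr_ge0// ltW.
have u1 : u <= 1 by rewrite ler_pdivrMr// mul1r lerDr.
have B : 1 - d%:R * u <= (1 - u) ^+ d by apply: bernoulli; rewrite u0.
move=> DuK; have {DuK} : D * (1 - d%:R * u) <= K.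
  by apply: le_trans DuK; rewrite ler_wpM2l.
have : D * d%:R * C < (D - K) * (n%:R + C).
  move: bn; rewrite ltr_pdivrMr// [ltRHS]mulrC => /lt_le_trans; apply.
  by rewrite ler_pM2l// lerDl.
rewrite -ltr_pdivrMr// -!mulrA -/u => h1 h2.
by lra.
Qed.

(** * Thickened members and large cubes *)

Section partition.
Context (R : realType) (d : nat) (d_gt0 : (0 < d)%N).
Context (N : 'rV[R]_d -> R) (normN : is_norm N).
Local Notation mu := (@lebesgue_outer R d).

(** With [a], [b], [M'] the [d]-th roots of the measure of [X], of [v] and of [M], Brunn-Minkowski
    gives [(a + e * b) ^+ d], and [a <= M'] gives [(1 + e * (b / M')) * a <= a + e * b]. *)
Lemma lebesgue_outer_thickening_ge (X : set 'rV[R]_d) (M e : R) :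
  0 < M -> 0 < e -> (mu X <= M%:E)%E ->
  (((1 + e * (fine (mu (norm_ball N 0 1)) / M) `^ d%:R^-1) ^+ d)%:E * mu X <=
    mu (thickening N X e))%E.
Proof.
move=> M0 e0 XM; set v := fine _.
have v0 : 0 <= v by rewrite fine_ge0// lebesgue_outer_ge0.
have sub : (mu X <= mu (thickening N X e))%E.
  by apply: le_lebesgue_outer; exact: sub_thickening.
(* The case [v = 0] also absorbs an infinite value, which [fine] sends to 0. The factor is then 1
   and inclusion suffices. *)
have [v_eq0|v_neq0] := eqVneq v 0.
  rewrite v_eq0 mul0r powR0 ?mulr0 ?addr0 ?expr1n ?mul1e//.
  by rewrite invr_eq0 pnatr_eq0 -lt0n.
have v_gt0 : 0 < v by rewrite lt0r v_neq0.
have [->|X_neq0] := eqVneq (mu X) 0%E.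
  by rewrite mule0 lebesgue_outer_ge0.
have Xfin : mu X \is a fin_num.
  by rewrite ge0_fin_numE ?lebesgue_outer_ge0// (le_lt_trans XM)// ltry.
have vfin : mu (norm_ball N 0 1) \is a fin_num.
  rewrite fin_numE; apply/andP; split; apply/eqP => h;
  by move: v_gt0; rewrite /v h ltxx.
pose m := fine (mu X).
have mE : mu X = m%:E by rewrite /m fineK.
have m_gt0 : 0 < m.
  rewrite fine_gt0// lt0e X_neq0 lebesgue_outer_ge0/=.
  by rewrite -ge0_fin_numE ?lebesgue_outer_ge0.
have mM : m <= M by rewrite -lee_fin -mE.
pose a := m `^ d%:R^-1; pose b := v `^ d%:R^-1; pose M' := M `^ d%:R^-1.
have ad : a ^+ d = m by rewrite powR_invn_exp// ltW.
have bd : b ^+ d = v by rewrite powR_invn_exp// ltW.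
have Md : M' ^+ d = M by rewrite powR_invn_exp// ltW.
have [a0 b0 M'0] : [/\ 0 < a, 0 < b & 0 < M'] by rewrite !powR_gt0.
have aM' : a <= M'.
  by apply: (ler_of_expr d_gt0 (ltW M'0)); rewrite ad Md.
have bM : (v / M) `^ d%:R^-1 = b / M'.
  have vM : 0 <= v / M by exact: divr_ge0 v0 (ltW M0).
  apply: (mulIf (lt0r_neq0 M'0)); rewrite divfK ?gt_eqF//.
  by rewrite -(powRM _ vM (ltW M0)) divfK ?gt_eqF.
clearbody a b M'.
apply: (@le_trans _ _ ((a + e * b) ^+ d)%:E).
  rewrite mE -EFinM lee_fin bM -ad -exprMn lerXn2r ?nnegrE//.
  - have bM0 : 0 <= b / M' by exact: divr_ge0 (ltW b0) (ltW M'0).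
    apply: mulr_ge0 (ltW a0); apply: addr_ge0 => //.
    exact: mulr_ge0 (ltW e0) bM0.
  - exact: addr_ge0 (ltW a0) (mulr_ge0 (ltW e0) (ltW b0)).
  - rewrite mulrDl mul1r lerD2l -mulrA ler_pM2l// mulrAC -mulrA.
    rewrite ler_piMr ?(ltW b0)// ler_pdivrMr//.
    by rewrite mul1r.
apply: brunn_minkowski_thickening => //.
  by rewrite ad mE.
by rewrite bd /v fineK.
Qed.

Definition cube (r : R) : 'rV[R]_d * 'rV[R]_d := (const_mx (- r), const_mx r).

Lemma lebesgue_outer_cube (r : R) : 0 <= r ->
  mu (box (cube r)) = ((r + r) ^+ d)%:E.
Proof.
move=> r0; rewrite lebesgue_outer_box /box_volume; congr EFin.
rewrite -[in RHS](card_ord d) -prodr_const; apply: eq_bigr => i _.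
by rewrite !mxE opprK max_r// addr_ge0.
Qed.

(** The norm dominates the coordinates, so [C] does not depend on [r]. This uniformity lets the
    volume ratio of the two cubes tend to 1. *)
Lemma thickening_cube (e : R) : 0 < e -> exists2 C : R, 0 <= C &
  forall X r, X `<=` box (cube r) -> thickening N X e `<=` box (cube (r + C)).
Proof.
move=> e0; have [c c0 cN] := is_norm_lower normN.
exists (c * e) => [|X r Xr p [x [/Xr xr xp]] i].
  by rewrite mulr_ge0// ltW.
have := xr i; rewrite !mxE => /andP[x1 x2].
have : `|x ord0 i - p ord0 i| < c * e.
  have := cN (x - p) i; rewrite !mxE => /le_lt_trans; apply.
  by rewrite ltr_pM2l.
by rewrite ltr_norml => /andP[h1 h2]; apply/andP; split; lra.
Qed.

(** The dyadic cells of level [n] tile the cube, and for large [n] each lies in the ball of radius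
    [e] around its upper corner. *)
Lemma cube_cover_finite (e : R) : 0 < e -> exists n0 : nat,
  forall n, (n0 <= n)%N -> exists (I : finType) (c : I -> 'rV[R]_d),
  box (cube n%:R) `<=` \bigcup_i norm_ball N (c i) e.
Proof.
move=> e0; have [C C0 CN] := is_norm_upper normN.
have b0 : 0 <= C / e by rewrite divr_ge0// ltW.
exists (Num.bound (C / e)) => n bn.
exists {ffun 'I_d -> 'I_((n * 2 ^ n).*2)}, (fun z => (dyadic_cell R z).2).
move=> x xn.
have [|z zx] := @exists_dyadic_cell R d n x.
  by move=> i; have := xn i; rewrite !mxE.
exists z => //; rewrite /norm_ball /=.
have n2 : C / e < 2 ^+ n.
  rewrite (lt_le_trans (archi_boundP b0))// -natrX ler_nat.
  by rewrite (leq_trans bn)// ltnW// ltn_expl.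
apply: (@le_lt_trans _ _ (C * (2 ^+ n)^-1)); last first.
  by rewrite ltr_pdivrMr ?exprn_gt0// mulrC -ltr_pdivrMr.
apply: CN; first by rewrite invr_ge0 exprn_ge0.
move=> i; have := zx i; rewrite /= !mxE.
rewrite -[(z i).+1%:R]natr1 mulrDl mul1r => /andP[h1 h2].
by rewrite ler_norml; apply/andP; split; lra.
Qed.

End partition.

(** * Counting members in large cubes *)

Theorem mainTheorem2 (R : realType) (d : nat) (d_gt0 : (0 < d)%N)
    (M : R) (M_gt0 : 0 < M)
    (P : set (set 'rV[R]_d)) (partP : partition P id [set: 'rV[R]_d])
    (outerP : forall A, P A -> (lebesgue_outer A <= M%:E)%E)
    (N : 'rV[R]_d -> R) (normN : is_norm N)
    (e : R) (e_gt0 : 0 < e) :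
  let v := fine (lebesgue_rV (norm_ball N 0 1)) in
  let k := `|Num.ceil ((1 + e * (v / M) `^ (d%:R)^-1) ^+ d)|%N in
  exists p : 'rV[R]_d,
    (`I_k #<= [set A | P A /\ A `&` norm_ball N p e !=set0])%card.
Proof.
move=> v k; pose D := (1 + e * (v / M) `^ (d%:R)^-1) ^+ d.
have kD : k = `|Num.ceil D|%N by [].
clearbody k.
have D1 : 1 <= D.
  by rewrite exprn_ege1// lerDl mulr_ge0 ?powR_ge0// ltW.
have D0 : 0 <= D by exact: le_trans D1.
(* Since [k] is the ceiling of [D], its predecessor is strictly below [D]; the contradiction will be
   [D <= k']. *)
have [k' kE k'D] : exists2 k', k = k'.+1 & k'%:R < D.
  have c0 : 0 < Num.ceil D by rewrite ceil_gt_int (lt_le_trans _ D1).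
  have kZ : k%:Z = Num.ceil D by rewrite kD gez0_abs// ltW.
  have k0 : (0 < k)%N by rewrite -ltz_nat kZ.
  exists k.-1; first by rewrite prednK.
  have := ceilB1_lt D; rewrite -kZ.
  by rewrite -{1}(prednK k0) -addn1 PoszD addrK.
pose members p := [set A | P A /\ A `&` norm_ball N p e !=set0].
apply: contrapT => /forallNP few.
have fin_members p : finite_set (members p).
  exact: finite_of_card_nle (few p).
have [C C0 thC] := thickening_cube normN e_gt0.
have [n0 coverS] := cube_cover_finite normN e_gt0.
suff : D <= k'%:R by rewrite leNgt k'D.
apply: (@le_of_scaled_le _ d n0 D _ C) => // n n0n n_gt0.
pose S := box (cube d n%:R : 'rV[R]_d * 'rV[R]_d).
have [I [c Sc]] := coverS n n0n.
have [s0 s0E] : exists s : seq (set 'rV[R]_d),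
    [set A | P A /\ A `&` S !=set0] = [set` s].
  (* Every member meeting the cube meets one of finitely many balls, and each ball meets finitely
     many members. *)
  apply/finite_seqP; apply: (@sub_finite_set _ _ (\bigcup_i members (c i))).
    move=> A [PA [x [Ax Sx]]]; have [i _ xi] := Sc x Sx.
    by exists i => //; split => //; exists x.
  by apply: bigcup_finite => // i _; exact: finite_finset.
(* Without repetitions, counting entries of the list counts distinct members. *)
pose s := undup s0.
have sP A : A \in s -> P A.
  rewrite mem_undup => As.
  by have : [set` s0] A by []; rewrite -s0E => -[].
pose U A := thickening N (A `&` S) e.
(* If [p] is in [U A], the ball around [p] meets [A]; hence [k'.+1] such members would contradict
   [few]. *)
have count_le p : (count (fun A => p \in U A) s <= k')%N.
  rewrite leqNgt -kE; apply/negP => kc; apply: (few p).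
  apply: card_le_trans (card_le_filter (undup_uniq _) kc) _.
  apply: subset_card_le => A [As]; rewrite inE => -[x [[Ax _] xp]].
  by split; [exact: sP|exists x].
have US A : U A `<=` box (cube d (n%:R + C)) by apply: thC => x [].
have upper : (\sum_(A <- s) lebesgue_outer (U A) <=
    (k'%:R * ((n%:R + C) + (n%:R + C)) ^+ d)%:E)%E.
  rewrite EFinM -lebesgue_outer_cube ?addr_ge0//.
  apply: lebesgue_outer_multiplicity => //.
  - by move=> A; exact: open_thickening.
  - exact: measurable_box.
have lower : ((D * (n%:R + n%:R) ^+ d)%:E <=
    \sum_(A <- s) lebesgue_outer (U A))%E.
  rewrite EFinM -lebesgue_outer_cube//.
  (* The pieces of the members in [S] cover [S], and thickening multiplies the measure of each piece
     by at least [D]. *)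
  apply: (@le_trans _ _ (D%:E * \sum_(A <- s) lebesgue_outer (A `&` S))%E).
    rewrite lee_pmul2l//; last by rewrite lte_fin (lt_le_trans _ D1).
    apply: le_trans (lebesgue_outer_bigcup_seq _ _).
    apply: le_lebesgue_outer => x Sx; have [covP _ _] := partP.
    have [A PA Ax] : cover P id x by rewrite covP.
    exists A => //=; rewrite mem_undup.
    suff : [set` s0] A by [].
    by rewrite -s0E; split => //; exists x.
  rewrite ge0_sume_distrr; last by move=> A _; exact: lebesgue_outer_ge0.
  rewrite big_seq [leRHS]big_seq; apply: lee_sum => A /sP PA.
  apply: lebesgue_outer_thickening_ge => //.
  by apply: le_trans (outerP A PA); apply: le_lebesgue_outer => x [].
have := le_trans lower upper; rewrite lee_fin.
have double (x : R) : (x + x) ^+ d = 2 ^+ d * x ^+ d.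
  by rewrite -exprMn; congr (_ ^+ _); ring.
rewrite (double n%:R) (double (n%:R + C)) mulrCA [leRHS]mulrCA.
by rewrite ler_pM2l// exprn_gt0.
Qed.
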